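(* For any (not necessarily constant) $1 \le d \le n$, there is an $H_{n/d}$-approximation algorithm for (weighted) \textsc{Set Cover} running in time $\mathrm{poly}(n,m)\cdot m^{O(d)}$.
   Context: An instance of weighted \textsc{Set Cover} consists of a finite universe $X$ of $n$ items, a collection $\mathcal S \subseteq 2^X$ of $m$ subsets of $X$ (``cover-sets''), and a nonnegative cost $c(S)$ for each $S\in\mathcal S$. A feasible solution is a subcollection $\mathcal C\subseteq\mathcal S$ with $\bigcup_{S\in\mathcal C}S = X$; the goal is to minimize $\sum_{S\in\mathcal C}c(S)$. An $\alpha$-approximation algorithm always outputs a feasible solution of cost at most $\alpha$ times the optimum. For real $k\ge 1$, $H_k=\sum_{j=1}^{\lfloor k\rfloor}1/j$. *)

(* Defs.v *)
From HB Require Import structures.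
From mathcomp Require Import all_boot all_order all_algebra.
From mathcomp Require Import reals exp.

Set Implicit Arguments.
Unset Strict Implicit.
Unset Printing Implicit Defensive.

Import Order.TTheory GRing.Theory Num.Theory.
Local Open Scope ring_scope.

(* The cover-sets are listed in an arbitrary order without repetition, so that
   a subcollection is the same thing as a set of indices. *)
Record instance (R : realType) (n m : nat) := Instance {
  cover_set : 'I_m -> {set 'I_n};
  cover_set_inj : injective cover_set;
  cost : 'I_m -> R;
  cost_ge0 : forall j, 0 <= cost j }.

Section SetCover.
Variables (R : realType) (n m : nat) (I : instance R n m).

Definition feasible (C : {set 'I_m}) : bool :=
  \bigcup_(j in C) cover_set I j == [set: 'I_n].

Definition total_cost (C : {set 'I_m}) : R := \sum_(j in C) cost I j.

Definition coverable : bool := feasible [set: 'I_m].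

(* Meaningful when I is coverable: the minimum then ranges over a nonempty
   family containing the default value [set: 'I_m]. *)
Definition optimum : R :=
  total_cost [arg min_(C < [set: 'I_m] | feasible C) total_cost C]%O.

Definition approximate_solution (alpha : R) (C : {set 'I_m}) : Prop :=
  feasible C /\ total_cost C <= alpha * optimum.

End SetCover.

Definition harmonic_number (R : realType) (k : R) : R :=
  \sum_(1 <= j < (Num.truncn k).+1) j%:R^-1.

(* Algorithms are programs for a unit-cost random access machine whose memory
   consists of arrays of natural numbers and arrays of real numbers; an array
   is designated by a fixed name and its cells are addressed indirectly.  The
   only arithmetic is addition and subtraction (truncated on naturals), and
   reals can influence the control flow only through comparisons.  Having
   neither multiplication nor rounding keeps unit cost realistic: in t steps
   naturals, and the integer coefficients of reals over the input, grow to
   O(t) bits beyond those of the input. *)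
Inductive nexp : Type :=
| NConst of nat
| NCell of nat & nexp
| NAdd of nexp & nexp
| NSub of nexp & nexp.

Inductive rexp : Type :=
| RZero
| ROne
| RCell of nat & nexp
| RAdd of rexp & rexp
| RSub of rexp & rexp.

Inductive bexp : Type :=
| BNLe of nexp & nexp
| BRLe of rexp & rexp
| BNot of bexp
| BAnd of bexp & bexp.

(* [NSet a i e] stores e in cell i of the array of naturals named a, and
   [RSet] does the same for arrays of reals. *)
Inductive program : Type :=
| Skip
| NSet of nat & nexp & nexp
| RSet of nat & nexp & rexp
| Seq of program & program
| If of bexp & program & program
| While of bexp & program.

(* Evaluating an expression takes one step per operation. *)
Fixpoint ntime (e : nexp) : nat :=
  match e with
  | NConst _ => 1
  | NCell _ i => (ntime i).+1
  | NAdd e1 e2 | NSub e1 e2 => (ntime e1 + ntime e2).+1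
  end.

Fixpoint rtime (e : rexp) : nat :=
  match e with
  | RZero | ROne => 1
  | RCell _ i => (ntime i).+1
  | RAdd e1 e2 | RSub e1 e2 => (rtime e1 + rtime e2).+1
  end.

Fixpoint btime (b : bexp) : nat :=
  match b with
  | BNLe e1 e2 => (ntime e1 + ntime e2).+1
  | BRLe e1 e2 => (rtime e1 + rtime e2).+1
  | BNot b1 => (btime b1).+1
  | BAnd b1 b2 => (btime b1 + btime b2).+1
  end.

Section Semantics.
Variable R : realType.

Record state := State {
  nmem : nat -> nat -> nat;
  rmem : nat -> nat -> R }.

Definition update (T : Type) (f : nat -> nat -> T) (a i : nat) (v : T) :
    nat -> nat -> T :=
  fun a' i' => if (a' == a) && (i' == i) then v else f a' i'.

Fixpoint neval (s : state) (e : nexp) : nat :=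
  match e with
  | NConst k => k
  | NCell a i => nmem s a (neval s i)
  | NAdd e1 e2 => neval s e1 + neval s e2
  | NSub e1 e2 => neval s e1 - neval s e2
  end.

Fixpoint reval (s : state) (e : rexp) : R :=
  match e with
  | RZero => 0
  | ROne => 1
  | RCell a i => rmem s a (neval s i)
  | RAdd e1 e2 => reval s e1 + reval s e2
  | RSub e1 e2 => reval s e1 - reval s e2
  end.

Fixpoint beval (s : state) (b : bexp) : bool :=
  match b with
  | BNLe e1 e2 => (neval s e1 <= neval s e2)%N
  | BRLe e1 e2 => reval s e1 <= reval s e2
  | BNot b1 => ~~ beval s b1
  | BAnd b1 b2 => beval s b1 && beval s b2
  end.

(* [exec P s t s']: started in state s, P halts in state s' after t steps. *)
Inductive exec : program -> state -> nat -> state -> Prop :=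
| exec_Skip s : exec Skip s 1 s
| exec_NSet s a i e :
    exec (NSet a i e) s (ntime i + ntime e).+1
      (State (update (nmem s) a (neval s i) (neval s e)) (rmem s))
| exec_RSet s a i e :
    exec (RSet a i e) s (ntime i + rtime e).+1
      (State (nmem s) (update (rmem s) a (neval s i) (reval s e)))
| exec_Seq P Q s t s1 u s2 :
    exec P s t s1 -> exec Q s1 u s2 -> exec (Seq P Q) s (t + u) s2
| exec_IfTrue b P Q s t s1 :
    beval s b -> exec P s t s1 -> exec (If b P Q) s (btime b + t).+1 s1
| exec_IfFalse b P Q s t s1 :
    ~~ beval s b -> exec Q s t s1 -> exec (If b P Q) s (btime b + t).+1 s1
| exec_WhileFalse b P s :
    ~~ beval s b -> exec (While b P) s (btime b).+1 s
| exec_WhileTrue b P s t s1 u s2 :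
    beval s b -> exec P s t s1 -> exec (While b P) s1 u s2 ->
    exec (While b P) s (btime b + t + u).+1 s2.

Lemma exec_deterministic P s t1 s1 t2 s2 :
  exec P s t1 s1 -> exec P s t2 s2 -> t1 = t2 /\ s1 = s2.
Proof.
move=> E1; elim: E1 t2 s2 => {P s t1 s1};
  try by [move=> ? ? ? E; inversion E | move=> ? ? ? ? ? ? E; inversion E].
- move=> P Q s t s1 u s2 _ IH1 _ IH2 t' s' E.
  inversion E as [| | |? ? ? ? ? ? ? E1 E2| | | |]; subst.
  by case: (IH1 _ _ E1) => ? ?; subst; case: (IH2 _ _ E2) => -> ->.
- move=> b P Q s t s1 sb _ IH t' s' E.
  inversion E as [| | | |? ? ? ? ? ? sb' E1|? ? ? ? ? ? sb' E1| |]; subst.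
    by case: (IH _ _ E1) => -> ->.
  by rewrite sb in sb'.
- move=> b P Q s t s1 sb _ IH t' s' E.
  inversion E as [| | | |? ? ? ? ? ? sb' E1|? ? ? ? ? ? sb' E1| |]; subst.
    by rewrite sb' in sb.
  by case: (IH _ _ E1) => -> ->.
- move=> b P s sb t' s' E.
  inversion E as [| | | | | |? ? ? sb'|? ? ? ? ? ? ? sb' E1 E2]; subst => //.
  by rewrite sb' in sb.
- move=> b P s t s1 u s2 sb _ IH1 _ IH2 t' s' E.
  inversion E as [| | | | | |? ? ? sb'|? ? ? ? ? ? ? sb' E1 E2]; subst.
    by rewrite sb in sb'.
  by case: (IH1 _ _ E1) => ? ?; subst; case: (IH2 _ _ E2) => -> ->.
Qed.

(* Arrays of naturals: array 0 holds n and m, array 1 the incidence matrix of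
   the cover-sets, one row of length n per cover-set.  Arrays of reals: array 0
   holds the parameter d, array 1 the costs.  All remaining cells are 0. *)
Definition input (n m : nat) (I : instance R n m) (d : R) : state :=
  State
    (fun a k =>
       match a, k with
       | 0, 0 => n
       | 0, 1 => m
       | 1, _ => [exists j, exists i in cover_set I j, k == j * n + i]%N : nat
       | _, _ => 0%N
       end)
    (fun a k =>
       match a, k with
       | 0, 0 => d
       | 1, _ => oapp (cost I) 0 (insub k)
       | _, _ => 0
       end).

Definition output (m : nat) (s : state) : {set 'I_m} :=
  [set j : 'I_m | nmem s 2 j != 0%N].

End Semantics.

(* Main.v *)
(* Let N be the integer part of n / d and let O be an optimal cover.  Taking,
   as long as possible, a set of O that still has more than N uncovered
   elements covers N + 1 > n / d new elements each time, so it stops after at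
   most D = floor d rounds.  The algorithm guesses these sets by trying all m^D
   tuples of D indices, completes every guess greedily, and keeps the cheapest
   cover found.
   For the right guess C every set of O has at most N residual elements, hence
   the potential cost(C) + sum_(S in O) c(S) H_(|S minus what C covers|) is at
   most H_N cost(O).  It does not increase along greedy: if the set picked
   covers e(S) residual elements of S, then c(S) (H_r - H_(r - e(S))) is at
   least e(S) c(S) / r with r the residual size of S, and c(S) / r is at least
   the price per new element of the greedy choice. *)
Require Import Defs.
From HB Require Import structures.
From mathcomp Require Import all_boot all_order all_algebra.
From mathcomp Require Import reals exp.
From mathcomp Require Import zify ring.

Set Implicit Arguments.
Unset Strict Implicit.
Unset Printing Implicit Defensive.

Import Order.TTheory GRing.Theory Num.Theory.
Local Open Scope ring_scope.

(** * Reasoning about running times *)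

Fixpoint writesN (P : program) : seq nat :=
  match P with
  | Skip | RSet _ _ _ => [::]
  | NSet a _ _ => [:: a]
  | Seq P1 P2 | If _ P1 P2 => writesN P1 ++ writesN P2
  | While _ P1 => writesN P1
  end.

Fixpoint writesR (P : program) : seq nat :=
  match P with
  | Skip | NSet _ _ _ => [::]
  | RSet a _ _ => [:: a]
  | Seq P1 P2 | If _ P1 P2 => writesR P1 ++ writesR P2
  | While _ P1 => writesR P1
  end.

(* The test of a loop is charged twice: once per iteration and once more for
   the final, failing test. *)
Fixpoint weight (P : program) : nat :=
  match P with
  | Skip => 1
  | NSet _ i e => (ntime i + ntime e).+1
  | RSet _ i e => (ntime i + rtime e).+1
  | Seq P1 P2 => weight P1 + weight P2
  | If b P1 P2 => (btime b + (weight P1 + weight P2)).+1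
  | While b P1 => (btime b).+1 + (btime b).+1 + weight P1
  end.

Section Hoare.
Variable R : realType.
Implicit Types (s : state R) (P : program) (Q : state R -> Prop).

(** The frame is tracked by whole arrays and read off the syntax, so for a concrete program each
    membership test is settled by computation. *)
Definition unchanged P s s' : Prop :=
  (forall a, a \notin writesN P -> nmem s' a = nmem s a) /\
  (forall a, a \notin writesR P -> rmem s' a = rmem s a).

Lemma unchanged_trans P s1 s2 s3 :
  unchanged P s1 s2 -> unchanged P s2 s3 -> unchanged P s1 s3.
Proof.
move=> [hn1 hr1] [hn2 hr2]; split=> a ha.
  by rewrite hn2 ?hn1.
by rewrite hr2 ?hr1.
Qed.

Lemma unchanged_sub P P' s s' :
  {subset writesN P <= writesN P'} -> {subset writesR P <= writesR P'} ->
  unchanged P s s' -> unchanged P' s s'.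
Proof.
move=> subN subR [hn hr]; split=> a ha; [apply: hn|apply: hr].
  by apply: contra ha; apply: subN.
by apply: contra ha; apply: subR.
Qed.

Lemma exec_unchanged P s t s' : exec P s t s' -> unchanged P s s'.
Proof.
elim=> {P s t s'} //=.
- by move=> s a i e; split=> // a' /=; rewrite inE /update => /negbTE ->.
- by move=> s a i e; split=> // a' /=; rewrite inE /update => /negbTE ->.
- move=> P Q s t s1 u s2 _ h1 _ h2; apply: unchanged_trans.
    by apply: unchanged_sub h1 => a; rewrite /= mem_cat => ->.
  by apply: unchanged_sub h2 => a; rewrite /= mem_cat orbC => ->.
- move=> b P Q s t s1 _ _; apply: unchanged_sub => a;
  by rewrite /= mem_cat => ->.
- move=> b P Q s t s1 _ _; apply: unchanged_sub => a;
  by rewrite /= mem_cat orbC => ->.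
- by move=> b P s t s1 u s2 _ _ h1 _; apply: unchanged_trans h1.
Qed.

(* Charging at most [X] for each syntactic operation, where [X] bounds the
   number of times it is repeated, spares all explicit constants. *)
Definition runs P s (X : nat) Q : Prop :=
  exists t s', [/\ exec P s t s', (t <= weight P * X)%N & Q s'].

(** Besides weakening the bound, it hands the frame condition to the continuation, so that
    specifications only have to mention what changes. *)
Lemma runs_conseq P s X Y Q Q' :
  runs P s X Q -> (X <= Y)%N ->
  (forall s', unchanged P s s' -> Q s' -> Q' s') -> runs P s Y Q'.
Proof.
move=> [t [s' [e le q]]] XY QQ'; exists t, s'; split=> //.
  by apply: leq_trans le _; rewrite leq_mul2l XY orbT.
by apply: QQ' => //; apply: exec_unchanged e.
Qed.

Lemma runs_skip s X Q : (0 < X)%N -> Q s -> runs Skip s X Q.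
Proof. by move=> X0 q; exists 1%N, s; split=> //; [constructor|rewrite mul1n]. Qed.

Lemma runs_nset a i e s X Q : (0 < X)%N ->
  Q (State (update (nmem s) a (neval s i) (neval s e)) (rmem s)) ->
  runs (NSet a i e) s X Q.
Proof.
move=> X0 q; exists (ntime i + ntime e).+1; eexists; split; first by constructor.
  by rewrite leq_pmulr.
exact: q.
Qed.

Lemma runs_rset a i e s X Q : (0 < X)%N ->
  Q (State (nmem s) (update (rmem s) a (neval s i) (reval s e))) ->
  runs (RSet a i e) s X Q.
Proof.
move=> X0 q; exists (ntime i + rtime e).+1; eexists; split; first by constructor.
  by rewrite leq_pmulr.
exact: q.
Qed.

Lemma runs_seq P1 P2 s X Q :
  runs P1 s X (fun s1 => runs P2 s1 X Q) -> runs (Seq P1 P2) s X Q.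
Proof.
move=> [t [s1 [e1 l1 [u [s2 [e2 l2 q]]]]]]; exists (t + u)%N, s2; split=> //.
  exact: exec_Seq e1 e2.
by rewrite /= mulnDl leq_add.
Qed.

Lemma runs_if b P1 P2 s X Q : (0 < X)%N ->
  (beval s b -> runs P1 s X Q) -> (~~ beval s b -> runs P2 s X Q) ->
  runs (If b P1 P2) s X Q.
Proof.
move=> X0 h1 h2; case: (boolP (beval s b)) => hb.
  have [t [s1 [e l q]]] := h1 hb.
  exists (btime b + t).+1, s1; split=> //; first exact: exec_IfTrue.
  rewrite /= -!addSn mulnDl leq_add ?leq_pmulr //.
  by rewrite mulnDl (leq_trans l) // leq_addr.
have [t [s1 [e l q]]] := h2 hb.
exists (btime b + t).+1, s1; split=> //; first exact: exec_IfFalse.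
rewrite /= -!addSn mulnDl leq_add ?leq_pmulr //.
by rewrite mulnDl (leq_trans l) // leq_addl.
Qed.

(** The variant [v] starts at most at [L] and drops at each pass, so there are at most [L] passes of
    cost [weight P * X], each with one test, and one last failing test. *)
Lemma runs_while b P s X L (Inv : state R -> Prop) (v : state R -> nat) :
  (0 < X)%N -> (0 < L)%N -> Inv s -> (v s <= L)%N ->
  (forall s1, unchanged P s s1 -> Inv s1 -> beval s1 b ->
     runs P s1 X (fun s2 => Inv s2 /\ (v s2 < v s1)%N)) ->
  runs (While b P) s (L * X) (fun s' => Inv s' /\ ~~ beval s' b).
Proof.
move=> X0 L0 inv vL step.
have: forall k s1, (v s1 <= k)%N -> unchanged P s s1 -> Inv s1 ->
  exists t s', [/\ exec (While b P) s1 t s',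
    (t <= k * ((btime b).+1 + weight P * X) + (btime b).+1)%N &
    Inv s' /\ ~~ beval s' b].
  elim=> [|k IH] s1 vk un1 inv1; case: (boolP (beval s1 b)) => hb.
  - by have [t [s2 [_ _ [_]]]] := step _ un1 inv1 hb; lia.
  - exists (btime b).+1, s1; split=> //; exact: exec_WhileFalse.
  - have [t [s2 [e2 l2 [inv2 lt]]]] := step _ un1 inv1 hb.
    have [||t' [s3 [e3 l3 q]]] := IH s2 _ _ inv2; first by lia.
      exact: unchanged_trans un1 (exec_unchanged e2).
    exists (btime b + t + t').+1, s3; split=> //.
      exact: exec_WhileTrue e2 e3.
    by move: l2 l3; rewrite mulSn; set p := (_ * X)%N; set r := (k * _)%N; lia.
  - exists (btime b).+1, s1; split=> //; first exact: exec_WhileFalse.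
    by rewrite leq_addl.
move=> /(_ L s vL) [//|//|t [s' [e l q]]].
exists t, s'; split=> //; apply: leq_trans l _.
(* One copy of the test in [weight] pays for the tests of the [L] passes, the other for the final
   one; both use that [L] and [X] are positive. *)
rewrite /= mulnDr addnC addnA mulnDl leq_add //; last by rewrite mulnCA.
by rewrite mulnDl leq_add // ?leq_pmulr ?muln_gt0 ?L0 // mulnC leq_mul2l leq_pmulr ?orbT.
Qed.

Definition NVar (a : nat) : nexp := NCell a (NConst 0).
Definition RVar (a : nat) : rexp := RCell a (NConst 0).
Definition NAssign (a : nat) (e : nexp) : program := NSet a (NConst 0) e.
Definition RAssign (a : nat) (e : rexp) : program := RSet a (NConst 0) e.
Definition NLt (e1 e2 : nexp) : bexp := BNLe (NAdd e1 (NConst 1)) e2.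
Definition NPos (e : nexp) : bexp := BNLe (NConst 1) e.

Definition For (x : nat) (e : nexp) (P : program) : program :=
  Seq (NAssign x (NConst 0))
      (While (NLt (NVar x) e) (Seq P (NAssign x (NAdd (NVar x) (NConst 1))))).

(** The bound [e] is evaluated anew at every test, hence the requirement that it keep its value [N].
    A positive [L], possibly above [N], also covers empty loops, whose failing test still costs
    time. *)
Lemma runs_for x e P s N X L (Inv : nat -> state R -> Prop) :
  (0 < X)%N -> (N <= L)%N -> (0 < L)%N -> x \notin writesN P ->
  (forall s1, unchanged (For x e P) s s1 -> neval s1 e = N) ->
  Inv 0%N (State (update (nmem s) x 0 0) (rmem s)) ->
  (forall k s1, (k < N)%N -> unchanged (For x e P) s s1 ->
     nmem s1 x 0 = k -> Inv k s1 ->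
     runs P s1 X (fun s2 =>
       Inv k.+1 (State (update (nmem s2) x 0 k.+1) (rmem s2)))) ->
  runs (For x e P) s (L * X) (Inv N).
Proof.
move=> X0 NL L0 xP he inv0 step.
have LX0 : (0 < L * X)%N by rewrite muln_gt0 L0.
apply: runs_seq; apply: runs_nset => //.
set s0 := State _ _.
have un0 : unchanged (For x e P) s s0.
  split=> // a; rewrite /= inE negb_or => /andP[ax _].
  by rewrite /update (negbTE ax).
have sub1 s1 s2 : unchanged P s1 s2 -> unchanged (For x e P) s1 s2.
  by apply: unchanged_sub => a; rewrite /= ?inE ?mem_cat => ->; rewrite ?orbT.
(* The number of completed rounds is read from the counter itself, which the body does not write. *)
pose I s1 := (nmem s1 x 0 <= N)%N /\ Inv (nmem s1 x 0) s1.
apply: (@runs_conseq _ _ (L * X) _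
  (fun s1 => I s1 /\ ~~ beval s1 (NLt (NVar x) e) /\
             unchanged (For x e P) s s1)) => //; last first.
  move=> s1 _ [[le inv]] [/= lt un]; move: lt.
  by rewrite (he _ un) addn1 -leqNgt => ge; have -> : N = nmem s1 x 0 by lia.
have xx0 (f : nat -> nat -> nat) k : update f x 0 k x 0 = k by rewrite /update !eqxx.
apply: (@runs_conseq _ _ (L * X) _ (fun s1 =>
  (I s1 /\ unchanged (For x e P) s s1) /\
  ~~ beval s1 (NLt (NVar x) e))) => //; last first.
  by move=> s1 _ [[]].
apply: (@runs_while _ _ _ _ _ _ (fun s1 => N - nmem s1 x 0)%N) => //.
- by rewrite /I /= xx0.
- by rewrite /= xx0 subn0.
move=> s1 _ [[le inv] un] /=; rewrite (he _ un) addn1 => lt.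
apply: runs_seq.
apply: runs_conseq (step _ _ lt un erefl inv) _ _ => // s2 un2 inv2.
have x2 : nmem s2 x = nmem s1 x by apply: un2.1.
apply: runs_nset => //=; rewrite x2 addn1.
have un3 : unchanged (For x e P) s1
    (State (update (nmem s2) x 0 (nmem s1 x 0).+1) (rmem s2)).
  apply: unchanged_trans (sub1 _ _ un2) _; split=> // a.
  rewrite /= inE negb_or => /andP[ax _].
  by rewrite /update (negbTE ax).
rewrite /I /= xx0; split; last by lia.
by split=> //; apply: unchanged_trans un un3.
Qed.

End Hoare.

(** * Greedy completion of a guess *)

Section Harmonic.
Variable R : realType.

(** Natural index version of [harmonic_number]: the latter unfolds to [hnum] at the truncation of
    its argument. *)
Definition hnum (k : nat) : R := \sum_(1 <= j < k.+1) j%:R^-1.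

(** Each of the [v - u] terms of the difference is the inverse of some [j <= v], hence at least
    [v^-1]. *)
Lemma hnum_diff (u v : nat) : (u <= v)%N ->
  (v - u)%:R / v%:R <= hnum v - hnum u :> R.
Proof.
move=> uv.
have -> : hnum v - hnum u = \sum_(u.+1 <= j < v.+1) j%:R^-1.
  by rewrite /hnum (@big_cat_nat _ _ _ u.+1) //= addrAC subrr add0r.
have -> : (v - u)%:R / v%:R = \sum_(u.+1 <= j < v.+1) v%:R^-1 :> R.
  by rewrite sumr_const_nat subSS mulr_natl.
apply: ler_sum_nat => j /andP[uj jv].
by rewrite lef_pV2 ?posrE ?ltr0n ?ler_nat; lia.
Qed.

Lemma hnum_le (u v : nat) : (u <= v)%N -> hnum u <= hnum v :> R.
Proof.
move=> uv; rewrite -subr_ge0; apply: le_trans (hnum_diff uv).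
by rewrite divr_ge0 ?ler0n.
Qed.
End Harmonic.

Section Greedy.
Variables (R : realType) (n m : nat) (I : instance R n m).
Implicit Types (C O : {set 'I_m}) (j S : 'I_m).

Definition covered C : {set 'I_n} := \bigcup_(j in C) cover_set I j.

Definition residual C j : {set 'I_n} := cover_set I j :\: covered C.

Lemma coveredU1 j C : covered (j |: C) = cover_set I j :|: covered C.
Proof.
rewrite /covered; apply/setP => x; apply/bigcupP/setUP.
  move=> [k]; rewrite in_setU1 => /orP[/eqP ->|kC] xk; first by left.
  by right; apply/bigcupP; exists k.
case=> [xj|/bigcupP[k kC xk]]; first by exists j; rewrite ?setU11.
by exists k => //; rewrite in_setU1 kC orbT.
Qed.

Lemma covered0 : covered set0 = set0.
Proof. by rewrite /covered big_set0. Qed.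

Lemma coveredS C C' : C \subset C' -> covered C \subset covered C'.
Proof.
move=> /subsetP CC'; apply/subsetP => x /bigcupP[k kC xk].
by apply/bigcupP; exists k => //; apply: CC'.
Qed.

Lemma residualS C C' j : C \subset C' -> residual C' j \subset residual C j.
Proof. by move=> /coveredS; apply: setDS. Qed.

Lemma residual_in C j : j \in C -> residual C j = set0.
Proof.
move=> jC; apply/eqP; rewrite setD_eq0; apply/subsetP => x xj.
by apply/bigcupP; exists j.
Qed.

Lemma residualU1 j C S : residual (j |: C) S = residual C S :\: cover_set I j.
Proof. by rewrite /residual coveredU1 setUC setDDl. Qed.

(* The second term bounds what greedy still has to pay to finish [C], charging
   the residual cover to the sets of [O]. *)
Definition potential O C : R :=
  total_cost I C + \sum_(S in O) cost I S * hnum R #|residual C S|.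

Lemma total_cost_le_potential O C : total_cost I C <= potential O C.
Proof.
rewrite lerDl; apply: sumr_ge0 => S _; rewrite mulr_ge0 ?cost_ge0 //.
by apply: sumr_ge0 => k _; rewrite invr_ge0 ler0n.
Qed.

(** The last hypothesis says that [j] has the least price per new element, multiplied out so that it
    also makes sense for sets with empty residual. The price of [j] is then paid by the drops of the
    harmonic terms. *)
Lemma potential_greedy O C j : feasible I O -> (0 < #|residual C j|)%N ->
  (forall S, cost I j * #|residual C S|%:R <= cost I S * #|residual C j|%:R) ->
  potential O (j |: C) <= potential O C.
Proof.
move=> Ofeas res_pos jmin; set a := #|residual C j| in res_pos jmin.
have jC : j \notin C.
  by apply/negP => /residual_in jC0; move: res_pos; rewrite /a jC0 cards0.
rewrite /potential {1}/total_cost big_setU1 //= -/(total_cost I C).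
rewrite addrAC [X in _ <= X]addrC lerD2r -lerBrDr -sumrB.
(* Each [S] in [O] is charged the unit price of [j] for every residual element that it shares with
   [j]. *)
pose e S := #|residual C S :&: cover_set I j|.
apply: (@le_trans _ _ (\sum_(S in O) cost I j / a%:R * (e S)%:R)); last first.
  apply: ler_sum => S _; rewrite -mulrBr residualU1.
  have [R0|Rpos] := posnP #|residual C S|.
    have : (e S <= 0)%N by rewrite -R0 subset_leq_card // subsetIl.
    rewrite leqn0 => /eqP ->; rewrite mulr0 mulr_ge0 ?cost_ge0 // subr_ge0.
    by apply: hnum_le; rewrite subset_leq_card // subsetDl.
  have De : (#|residual C S| - #|residual C S :\: cover_set I j|)%N = e S.
    by rewrite /e -(cardsID (cover_set I j) (residual C S)) addnK.
  have le1 := @hnum_diff R _ _ (subset_leq_card (subsetDl (residual C S) (cover_set I j))).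
  apply: le_trans (ler_wpM2l (cost_ge0 I S) le1); rewrite De.
  rewrite [leRHS]mulrCA [leLHS]mulrC ler_wpM2l ?ler0n //.
  by rewrite ler_pdivrMr ?ltr0n // mulrAC ler_pdivlMr ?ltr0n.
(* It remains to see that the charges sum to at least [cost I j]: since [O] covers every item, its
   sets together meet all [a] new elements of [j]. *)
rewrite -mulr_sumr -natr_sum mulrAC ler_pdivlMr ?ltr0n //.
rewrite ler_wpM2l ?cost_ge0 // ler_nat.
apply: (@leq_trans #|\bigcup_(S in O) (residual C S :&: cover_set I j)|).
  apply/subset_leq_card/subsetP => x; rewrite in_setD => /andP[xC xj].
  have : x \in \bigcup_(S in O) cover_set I S by rewrite (eqP Ofeas) inE.
  move=> /bigcupP[S SO xS]; apply/bigcupP; exists S => //.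
  by rewrite !inE xC xS.
rewrite /e; elim/big_ind2: _ => [|A p B q Ap Bq|//]; first by rewrite cards0.
by apply: leq_trans (leq_card_setU _ _) _; rewrite leq_add.
Qed.

Lemma residual_gt0 C : coverable I -> covered C != [set: 'I_n] ->
  exists j, (0 < #|residual C j|)%N.
Proof.
move=> Icov; rewrite -subTset => /subsetPn[x _ xC].
have : x \in \bigcup_(j in [set: 'I_m]) cover_set I j by rewrite (eqP Icov) inE.
move=> /bigcupP[j _ xj]; exists j; rewrite card_gt0; apply/set0Pn.
by exists x; rewrite inE xC.
Qed.

Lemma uncovered_greedy C j : (0 < #|residual C j|)%N ->
  (#|~: covered (j |: C)| < #|~: covered C|)%N.
Proof.
rewrite card_gt0 => /set0Pn[x]; rewrite inE => /andP[xC xj].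
apply: proper_card; apply/properP; split.
  by rewrite setCS coveredU1 subsetUr.
by exists x; rewrite ?inE // coveredU1 inE xj.
Qed.

(** * Existence of a good guess *)

Lemma small_residuals O (N D : nat) : (n < N.+1 * D.+1)%N ->
  exists l : seq 'I_m, [/\ (size l <= D)%N, [set S in l] \subset O &
    forall S, S \in O -> (#|residual [set S in l] S| <= N)%N].
Proof.
move=> nND.
(* After [p] rounds, either no set of [O] has a large residual any more, or every round has covered
   at least [N.+1] new elements. *)
have: forall p, exists l : seq 'I_m, [/\ (size l <= p)%N, [set S in l] \subset O &
    (forall S, S \in O -> (#|residual [set S in l] S| <= N)%N) \/
    (p * N.+1 <= #|covered [set S in l]|)%N].
  elim=> [|p [l [lp lO [lN|cov]]]].
  - by exists [::]; split; [by []|by apply/subsetP => x; rewrite inE|right; rewrite mul0n].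
  - by exists l; split; [exact: leqW|exact: lO|left].
  - have [/forall_inP small|] :=
      boolP [forall (S | S \in O), #|residual [set S in l] S| <= N]%N.
      by exists l; split; [exact: leqW|exact: lO|left].
    rewrite negb_forall_in => /exists_inP[S SO]; rewrite -ltnNge => big.
    have cE : [set T in S :: l] = S |: [set S in l].
      by apply/setP => x; rewrite !inE.
    exists (S :: l); split; first exact: lp.
      by rewrite cE subUset sub1set SO.
    right; rewrite cE coveredU1 mulSn.
    have : #|cover_set I S :|: covered [set T in l]| =
        (#|residual [set T in l] S| + #|covered [set T in l]|)%N.
      rewrite -(cardsID (covered [set T in l])) setUC setUK.
      by rewrite setDUl setDv set0U addnC.
    by move=> ->; rewrite leq_add.
(* If [D] rounds all gained [N.+1] elements, one more large residual would give [N.+1 * D.+1] items,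
   more than [n]. *)
move=> /(_ D)[l [lD lO [lN|cov]]]; exists l; split=> // S _.
rewrite leqNgt; apply/negP => big.
have : (#|covered [set S in l]| + #|residual [set S in l] S| <= n)%N.
  rewrite -[n in (_ <= n)%N]card_ord -[#|'I_n|]cardsT.
  rewrite -(cardsID (covered [set S in l]) [set: 'I_n]) setTI leq_add2l.
  by rewrite subset_leq_card // setSD // subsetT.
by lia.
Qed.

Lemma guess_exists O (N D : nat) : feasible I O ->
  (0 < n)%N -> (0 < N)%N -> (0 < D)%N -> (n < N.+1 * D.+1)%N ->
  exists l : seq 'I_m, size l = D /\
    potential O [set S in l] <= hnum R N * total_cost I O.
Proof.
move=> Ofeas n0 N0 D0 nND.
have [l0 [l0D l0O small0]] := small_residuals O nND.
have [S0 S0O] : exists S0, S0 \in O.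
  have : Ordinal n0 \in covered O by rewrite /covered (eqP Ofeas) inE.
  by case/bigcupP => S SO _; exists S.
(* The program only tries tuples of length exactly [D]; repeating a member of [O] pads the guess
   while keeping it inside [O]. *)
set l := l0 ++ nseq (D - size l0) S0; exists l.
split; first by rewrite size_cat size_nseq subnKC.
have lO : [set S in l] \subset O.
  apply/subsetP => S; rewrite inE mem_cat => /orP[Sl0|].
    by apply: (subsetP l0O); rewrite inE.
  by rewrite mem_nseq => /andP[_ /eqP ->].
(* Split [O] into guessed and other sets. A guessed set has no residual and contributes its cost, at
   most [hnum R N] times it because [N] is positive; any other has residual at most [N]. *)
rewrite /potential /total_cost [X in _ + X](big_setID [set S in l]) /= mulr_sumr.
rewrite [leRHS](big_setID [set S in l]) /= (setIidPr lO) addrA -big_split /=.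
rewrite lerD //; apply: ler_sum => S.
  move=> Sl; rewrite residual_in // cards0 /hnum big_geq // mulr0 addr0.
  rewrite ler_peMl ?cost_ge0 // -(prednK N0) big_nat_recl //= invr1 lerDl.
  by apply: sumr_ge0 => k _; rewrite invr_ge0 ler0n.
rewrite inE => /andP[_ SO]; rewrite mulrC ler_wpM2r ?cost_ge0 //.
apply/hnum_le/(leq_trans _ (small0 S SO))/subset_leq_card/residualS.
by apply/subsetP => T; rewrite !inE mem_cat => ->.
Qed.

End Greedy.

(* The guess of at most [D] cover-sets coded by the number [c < m ^ D]. *)
Fixpoint digits (m D c : nat) : {set 'I_m} :=
  if D is D'.+1 then [set j : 'I_m | j == c %% m :> nat]%N :|: digits m D' (c %/ m)%N
  else set0.

(** The code reads [l] as a number in base [m] whose least significant digit is the head. *)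
Lemma digits_surj (m : nat) (l : seq 'I_m) :
  exists2 c, (c < m ^ size l)%N & digits m (size l) c = [set j in l].
Proof.
elim: l => [|x l [c cl lE]].
  by exists 0%N => //; apply/setP => j; rewrite !inE.
have xm := ltn_ord x; exists (c * m + x)%N.
  by rewrite /= expnSr; nia.
rewrite /= divnMDl ?(leq_ltn_trans _ xm) // divn_small // addn0 lE.
by rewrite modnMDl modn_small //; apply/setP => j; rewrite !inE.
Qed.

(** * The program *)

(* Arrays of naturals; the first three are those of [input] and [output]. *)
Notation SIZE := 0%N (only parsing).
Notation INC := 1%N (only parsing).
Notation OUT := 2%N (only parsing).
Notation DEPTH := 3%N (only parsing).
Notation GUESSES := 4%N (only parsing).
Notation ROW := 5%N (only parsing).
Notation SEL := 6%N (only parsing).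
Notation UNC := 7%N (only parsing).
Notation GUESS := 8%N (only parsing).
Notation REST := 9%N (only parsing).
Notation QUO := 10%N (only parsing).
Notation IT := 11%N (only parsing).
Notation CNT := 12%N (only parsing).
Notation BESTJ := 13%N (only parsing).
Notation BESTN := 14%N (only parsing).
Notation JT := 15%N (only parsing).
Notation PICK := 16%N (only parsing).
Notation KT := 17%N (only parsing).

(* Arrays of reals; the first two are those of [input]. *)
Notation PARAM := 0%N (only parsing).
Notation COST := 1%N (only parsing).
Notation BEST := 2%N (only parsing).
Notation TOTAL := 3%N (only parsing).
Notation PROD1 := 4%N (only parsing).
Notation PROD2 := 5%N (only parsing).
Notation FLOOR := 6%N (only parsing).

Definition n_items : nexp := NCell SIZE (NConst 0).
Definition n_sets : nexp := NCell SIZE (NConst 1).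
Definition NIncr (a : nat) (e : nexp) : program := NAssign a (NAdd (NVar a) e).
Definition RIncr (a : nat) (e : rexp) : program := RAssign a (RAdd (RVar a) e).

(** [ROW] tabulates the offsets [j * n] of the incidence matrix, as the machine has no
    multiplication. *)
Definition contains (j : nexp) : bexp :=
  NPos (NCell INC (NAdd (NCell ROW j) (NVar IT))).

Definition fill (a : nat) (e v : nexp) : program :=
  For IT e (NSet a (NVar IT) v).

Definition pick_set : program :=
  Seq (NSet SEL (NVar PICK) (NConst 1))
      (For IT n_items
        (If (contains (NVar PICK)) (NSet UNC (NVar IT) (NConst 0)) Skip)).

Definition count_new : program :=
  Seq (NAssign CNT (NConst 0))
      (For IT n_items
        (If (BAnd (contains (NVar JT)) (NPos (NCell UNC (NVar IT))))
            (NIncr CNT (NConst 1)) Skip)).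

(** Prices per element are compared after multiplying out; the products are repeated sums. *)
Definition multiply_cost (a : nat) (e j : nexp) : program :=
  Seq (RAssign a RZero) (For IT e (RIncr a (RCell COST j))).

(* Costs are nonnegative and [BESTN] starts at 0, so the test succeeds for the
   first set that has a new element. *)
Definition consider : program :=
  Seq count_new
 (Seq (multiply_cost PROD1 (NVar BESTN) (NVar JT))
 (Seq (multiply_cost PROD2 (NVar CNT) (NVar BESTJ))
      (If (BAnd (NPos (NVar CNT)) (BRLe (RVar PROD1) (RVar PROD2)))
          (Seq (NAssign BESTJ (NVar JT)) (NAssign BESTN (NVar CNT)))
          Skip))).

Definition find_best : program :=
  Seq (NAssign BESTJ (NConst 0))
 (Seq (NAssign BESTN (NConst 0))
      (For JT n_sets consider)).

Definition greedy_step : program :=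
  Seq find_best
      (If (NPos (NVar BESTN)) (Seq (NAssign PICK (NVar BESTJ)) pick_set) Skip).

(** Every useful step covers a new item, so [n] rounds suffice; the remaining ones are idle. *)
Definition greedy : program := For KT n_items greedy_step.

(* Repeated subtraction may take [m ^ D] steps; this merely squares the number
   of guesses in the running time. *)
Definition divide : program :=
  Seq (NAssign QUO (NConst 0))
      (While (BNLe n_sets (NVar REST))
        (Seq (NAssign REST (NSub (NVar REST) n_sets)) (NIncr QUO (NConst 1)))).

Definition pick_guess : program :=
  Seq (NAssign REST (NVar GUESS))
      (For KT (NVar DEPTH)
        (Seq divide
        (Seq (NAssign PICK (NVar REST))
        (Seq pick_set (NAssign REST (NVar QUO)))))).

Definition compute_total : program :=
  Seq (RAssign TOTAL RZero)
      (For IT n_sets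
        (If (NPos (NCell SEL (NVar IT)))
            (RIncr TOTAL (RCell COST (NVar IT))) Skip)).

Definition save : program :=
  Seq (RAssign BEST (RVar TOTAL)) (fill OUT n_sets (NCell SEL (NVar IT))).

Definition attempt : program :=
  Seq (fill SEL n_sets (NConst 0))
 (Seq (fill UNC n_items (NConst 1))
 (Seq pick_guess
 (Seq greedy
 (Seq compute_total
      (If (BRLe (RVar TOTAL) (RVar BEST)) save Skip))))).

(** The first offset is the initial 0 of the memory. *)
Definition compute_rows : program :=
  For JT n_sets
    (NSet ROW (NAdd (NVar JT) (NConst 1)) (NAdd (NCell ROW (NVar JT)) n_items)).

(** Counts up to the integer part of the parameter. Naturals cannot be compared with reals, so the
    counter is kept in both forms. *)
Definition compute_depth : program :=
  While (BRLe (RAdd (RVar FLOOR) ROne) (RVar PARAM))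
    (Seq (RIncr FLOOR ROne) (NIncr DEPTH (NConst 1))).

Definition compute_guesses : program :=
  Seq (NAssign GUESSES (NConst 1))
      (For KT (NVar DEPTH)
        (Seq (NAssign CNT (NConst 0))
        (Seq (For JT n_sets (NIncr CNT (NVar GUESSES)))
             (NAssign GUESSES (NVar CNT))))).

(** The first record is the family of all cover-sets, so a feasible cover is stored from the
    start. *)
Definition initialize : program :=
  Seq compute_rows
 (Seq compute_depth
 (Seq compute_guesses
 (Seq (fill SEL n_sets (NConst 1))
 (Seq compute_total save)))).

Definition set_cover_program : program :=
  Seq initialize (For GUESS (NVar GUESSES) attempt).

(** * Memory layout and invariants *)

Section Correctness.
Variables (R : realType) (n m : nat) (I : instance R n m) (d : R).
Implicit Types (s : state R).

Definition loaded s : Prop :=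
  [/\ nmem s SIZE 0 = n, nmem s SIZE 1 = m, nmem s INC = nmem (input I d) INC,
      rmem s COST = rmem (input I d) COST &
      forall j, (j < m)%N -> nmem s ROW j = (j * n)%N].

Definition chosen s : {set 'I_m} := [set j : 'I_m | nmem s SEL j != 0]%N.
Definition uncovered s : {set 'I_n} := [set i : 'I_n | nmem s UNC i != 0]%N.
Definition consistent s : Prop := uncovered s = ~: covered I (chosen s).

Lemma loaded_unchanged P s s' : unchanged P s s' ->
  all [predC writesN P] [:: SIZE; INC; ROW] -> COST \notin writesR P ->
  loaded s -> loaded s'.
Proof.
move=> [hn hr] /and4P[h0 h1 h5 _] hc [n0 n1 inc cst row].
by split; rewrite ?hn ?hr.
Qed.

(** Division by [n] recovers [j] and [i] from [j * n + i], so distinct pairs occupy distinct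
    cells. *)
Lemma loaded_contains s (j : 'I_m) (i : 'I_n) : loaded s ->
  nmem s INC (nmem s ROW j + i) = (i \in cover_set I j) :> nat.
Proof.
move=> [_ _ -> _ row]; rewrite row //=; congr nat_of_bool.
apply/existsP/idP => [[j' /existsP[i' /andP[ij /eqP e]]]|ij]; last first.
  by exists j; apply/existsP; exists i; rewrite ij eqxx.
have n0 : (0 < n)%N by apply: leq_ltn_trans (ltn_ord i).
have ej : j = j'.
  apply: val_inj => /=; move: (congr1 (divn^~ n) e).
  by rewrite !divnMDl // !divn_small ?addn0.
have -> : i = i' by apply: val_inj => /=; move: e; rewrite ej => /addnI.
by rewrite ej.
Qed.

Lemma loaded_cost s (j : 'I_m) : loaded s -> rmem s COST j = cost I j.
Proof. by move=> [_ _ _ -> _]; rewrite /= valK. Qed.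

(** Common bound for all loops over items, cover-sets, digits of a guess or residual sizes. *)
Let B := (n + m)%N.
Hypothesis m_gt0 : (0 < m)%N.

Let B_gt0 : (0 < B)%N. Proof. by rewrite addn_gt0 m_gt0 orbT. Qed.
Let nB : (n <= B)%N. Proof. exact: leq_addr. Qed.
Let mB : (m <= B)%N. Proof. exact: leq_addl. Qed.

(** * Selecting a set, counting new elements and multiplying costs *)

Lemma runs_pick_set s (j : 'I_m) : loaded s -> nmem s PICK 0 = j ->
  consistent s ->
  runs pick_set s B (fun s' => chosen s' = j |: chosen s /\ consistent s').
Proof.
move=> ld pj cons; apply: runs_seq; apply: runs_nset => //=.
set s0 := State _ _; rewrite -{1}[B]muln1.
pose Inv k s1 := forall i : nat, nmem s1 UNC i =
  if (i < k)%N && (0 < nmem s INC (nmem s ROW j + i))%N then 0%N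
  else nmem s UNC i.
apply: (@runs_conseq _ _ _ (B * 1) _ (Inv n)) => //.
  apply: runs_for => //.
  - by move=> s1 un1 /=; rewrite (un1.1 SIZE isT) //; case: ld.
  move=> k s1 kn un1 itk inv1.
  have e1 : (0 < nmem s1 INC (nmem s1 ROW (nmem s1 PICK 0) + k))%N =
            (0 < nmem s INC (nmem s ROW j + k))%N.
    by rewrite (un1.1 INC isT) (un1.1 ROW isT) (un1.1 PICK isT) /= -pj.
  apply: runs_if => //=; rewrite itk e1 => h.
    apply: runs_nset => //= i; rewrite /= itk /update /= ltnS (leq_eqVlt i).
    by case: eqP => [->|_] /=; [rewrite h|apply: inv1].
  apply: runs_skip => // i; rewrite /update /= inv1 ltnS (leq_eqVlt i).
  by case: eqP => [->|//]; rewrite (negbTE h) !andbF.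
move=> s1 un1 inv1.
have ch1 : chosen s1 = j |: chosen s.
  apply/setP => k; rewrite !inE (un1.1 SEL isT) /= /update pj -val_eqE /=.
  by case: ifP.
split=> //; rewrite /consistent ch1 coveredU1 setCU -cons.
apply/setP => i; rewrite !inE inv1 ltn_ord (loaded_contains _ _ ld) lt0b.
by case: (i \in _).
Qed.

Lemma runs_fill a v s N (f : nat -> nat) (x : nat) :
  a \notin [:: SIZE; IT] -> (N <= B)%N ->
  (x <= 1)%N -> nmem s SIZE x = N ->
  (forall k s1, (k < N)%N -> unchanged (fill a (NCell SIZE (NConst x)) v) s s1 ->
     nmem s1 IT 0 = k -> neval s1 v = f k) ->
  runs (fill a (NCell SIZE (NConst x)) v) s B
    (fun s' => forall i, (i < N)%N -> nmem s' a i = f i).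
Proof.
rewrite !inE negb_or => /andP[a0 aIT] NB x1 sN fE; rewrite -[B]muln1.
pose Inv k s1 := forall i, (i < k)%N -> nmem s1 a i = f i.
apply: (runs_for (Inv := Inv)) => //.
- by rewrite inE eq_sym.
- by move=> s1 un1 /=; rewrite un1.1 //= !inE (eq_sym _ a) (negbTE a0).
move=> k s1 kN un1 itk inv1; apply: runs_nset => // i.
rewrite /= /update (negbTE aIT) itk eqxx /= ltnS leq_eqVlt.
by case: eqP => [-> _|_ /= /inv1] //; apply: fE.
Qed.

Lemma runs_count_new s (j : 'I_m) : loaded s -> nmem s JT 0 = j ->
  consistent s ->
  runs count_new s B (fun s' => nmem s' CNT 0 = #|residual I (chosen s) j|).
Proof.
move=> ld jj cons; apply: runs_seq; apply: runs_nset => //=.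
set s0 := State _ _; rewrite -{1}[B]muln1.
pose p i := (0 < nmem s INC (nmem s ROW j + i))%N && (0 < nmem s UNC i)%N.
pose Inv k s1 := nmem s1 CNT 0 = (\sum_(0 <= i < k) p i)%N.
apply: (@runs_conseq _ _ _ (B * 1) _ (Inv n)) => //.
  apply: runs_for => //.
  - by move=> s1 un1 /=; rewrite (un1.1 SIZE isT) //; case: ld.
  - by rewrite /Inv big_geq.
  move=> k s1 kn un1 itk inv1.
  have e1 : (0 < nmem s1 INC (nmem s1 ROW (nmem s1 JT 0) + k))%N &&
            (0 < nmem s1 UNC k)%N = p k.
    rewrite (un1.1 INC isT) (un1.1 ROW isT) (un1.1 JT isT) (un1.1 UNC isT) /=.
    by rewrite /update /= jj.
  apply: runs_if => //=; rewrite itk e1 => h.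
    by apply: runs_nset => //; rewrite /Inv /= big_nat_recr //= h -inv1.
  by apply: runs_skip => //; rewrite /Inv /= big_nat_recr //= (negbTE h) addn0.
move=> s1 un1 ->; rewrite big_mkord -sum1_card.
rewrite [in RHS]big_mkcond /=.
apply: eq_bigr => i _; rewrite /p (loaded_contains _ _ ld) lt0b.
rewrite in_setD -in_setC -cons inE lt0n andbC.
by case: (_ && _).
Qed.

Lemma runs_multiply_cost a x y s (j : 'I_m) k :
  [&& a != COST, x != IT & y != IT] -> (k <= B)%N -> loaded s ->
  nmem s x 0 = k -> nmem s y 0 = j ->
  runs (multiply_cost a (NVar x) (NVar y)) s B
    (fun s' => rmem s' a 0 = cost I j * k%:R).
Proof.
move=> /and3P[aC xI yI] kB ld xk yj; apply: runs_seq; apply: runs_rset => //=.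
set s0 := State _ _; rewrite -[B]muln1.
pose Inv k s1 := rmem s1 a 0 = cost I j * k%:R.
apply: (runs_for (Inv := Inv)) => //.
- by move=> s1 un1 /=; rewrite un1.1 //= !inE (negbTE xI).
- by rewrite /Inv /= /update !eqxx mulr0.
move=> i s1 _ un1 _ inv1; apply: runs_rset => //.
rewrite /Inv /= /update !eqxx /= inv1 (un1.1 y) /= ?inE ?(negbTE yI) // yj.
have Ca : (COST == a) = false by rewrite eq_sym (negbTE aC).
rewrite (un1.2 COST) /= ?inE ?Ca // /update Ca /= (loaded_cost _ ld).
by rewrite mulrS mulrDr mulr1 addrC.
Qed.

(** * The greedy choice and the greedy completion *)

(** While [r] is 0, no set with a new element has been met and [b] is a mere placeholder; afterwards
    [b] has the least price per new element so far. *)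
Definition best_upto (C : {set 'I_m}) (k : nat) (b : 'I_m) (r : nat) : Prop :=
  r = 0%N /\ (forall j : 'I_m, (j < k)%N -> #|residual I C j| = 0%N) \/
  [/\ r = #|residual I C b|, (0 < r)%N &
      forall j : 'I_m, (j < k)%N ->
        cost I b * #|residual I C j|%:R <= cost I j * r%:R].

Lemma best_upto_le C k b r : best_upto C k b r -> (r <= B)%N.
Proof.
move=> [[-> //]|[-> _ _]]; apply: leq_trans nB.
by rewrite -[n in (_ <= n)%N]card_ord max_card.
Qed.

Lemma best_upto_step C (j b : 'I_m) r (r' := #|residual I C j|) :
  best_upto C j b r ->
  if (0 < r')%N && (cost I j * r%:R <= cost I b * r'%:R)
  then best_upto C j.+1 j r' else best_upto C j.+1 b r.
Proof.
case: posnP => [r'0|r'_gt0] /=.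
  case=> [[-> h]|[-> r0 h]]; [left|right]; split=> // i; rewrite ltnS leq_eqVlt;
  case/orP => [/eqP/val_inj ->|/h] //.
  by rewrite -/r' r'0 mulr0 mulr_ge0 ?cost_ge0 ?ler0n.
case: ifPn => [le|nle].
  move=> best; right; split=> // i; rewrite ltnS leq_eqVlt.
  case/orP => [/eqP/val_inj -> //|ij].
  case: best => [[_ /(_ i ij) ->]|[_ r0 /(_ i ij) h]].
    by rewrite mulr0 mulr_ge0 ?cost_ge0 ?ler0n.
  (* The comparisons of [j] with [b] and of [b] with [i] are chained after multiplying by the
     positive residual size [r] of [b]. *)
  rewrite -(@ler_pM2r _ r%:R) ?ltr0n // mulrAC.
  apply: le_trans (ler_wpM2r (ler0n _ _) le) _.
  by rewrite mulrAC [leRHS]mulrAC ler_wpM2r ?ler0n.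
case=> [[r0 _]|[rb r0 h]].
  by case/negP: nle; rewrite r0 mulr0 mulr_ge0 ?cost_ge0 ?ler0n.
right; split=> // i; rewrite ltnS leq_eqVlt.
case/orP => [/eqP/val_inj ->|/h //]; apply: ltW; by rewrite ltNge.
Qed.

Lemma runs_find_best s : loaded s -> consistent s ->
  runs find_best s (B * B) (fun s' => exists b : 'I_m,
    nmem s' BESTJ 0 = b /\ best_upto (chosen s) m b (nmem s' BESTN 0)).
Proof.
move=> ld cons; have BB : (0 < B * B)%N by rewrite muln_gt0 B_gt0.
apply: runs_seq; apply: runs_nset => //; apply: runs_seq; apply: runs_nset => //=.
set s0 := State _ _.
pose Inv k s1 := exists b : 'I_m,
  nmem s1 BESTJ 0 = b /\ best_upto (chosen s) k b (nmem s1 BESTN 0).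
apply: (runs_for (Inv := Inv)) => //.
- by move=> s1 un1 /=; rewrite (un1.1 SIZE isT); case: ld.
(* The initial value 0 of [BESTJ] is a legitimate index because [m] is positive. *)
- by exists (Ordinal m_gt0); split=> //; left.
move=> k s1 km un1 jk [b [eb best]]; set j := Ordinal km.
have ld1 : loaded s1 by apply: loaded_unchanged un1 _ _ _.
have ch1 : chosen s1 = chosen s by rewrite /chosen (un1.1 SEL isT).
have cons1 : consistent s1.
  by rewrite /consistent ch1 /uncovered (un1.1 UNC isT).
apply: runs_seq.
apply: runs_conseq (runs_count_new (j := j) ld1 jk cons1) (leqnn _) _ => s2 un2 cnt2.
have ld2 : loaded s2 by apply: loaded_unchanged un2 _ _ _.
have le_r := best_upto_le best.
apply: runs_seq.
apply: runs_conseq (@runs_multiply_cost PROD1 BESTN JT s2 j _ isT le_r ld2 _ _) (leqnn _) _.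
- by rewrite (un2.1 BESTN isT).
- by rewrite (un2.1 JT isT).
move=> s3 un3 prod3.
have ld3 : loaded s3 by apply: loaded_unchanged un3 _ _ _.
apply: runs_seq.
apply: runs_conseq (@runs_multiply_cost PROD2 CNT BESTJ s3 b
  #|residual I (chosen s) j| isT _ ld3 _ _) (leqnn _) _.
- by rewrite (leq_trans _ nB) // -[n in (_ <= n)%N]card_ord max_card.
- by rewrite (un3.1 CNT isT) cnt2 ch1.
- by rewrite (un3.1 BESTJ isT) (un2.1 BESTJ isT).
move=> s4 un4 prod4.
have step := @best_upto_step (chosen s) j b _ best.
have cnt4 : nmem s4 CNT 0 = #|residual I (chosen s) j|.
  by rewrite (un4.1 CNT isT) (un3.1 CNT isT) cnt2 ch1.
have jt4 : nmem s4 JT 0 = k.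
  by rewrite (un4.1 JT isT) (un3.1 JT isT) (un2.1 JT isT).
apply: runs_if => //=; rewrite cnt4 prod4 (un4.2 PROD1 isT) prod3 => h; move: step.
  rewrite h => best'; apply: runs_seq; apply: runs_nset => //; apply: runs_nset => //.
  by exists j; rewrite /= /update /= cnt4 jt4.
rewrite (negbTE h) => best'; apply: runs_skip => //; exists b; split => /=.
  by rewrite /update /= (un4.1 BESTJ isT) (un3.1 BESTJ isT) (un2.1 BESTJ isT).
by rewrite /update /= (un4.1 BESTN isT) (un3.1 BESTN isT) (un2.1 BESTN isT).
Qed.

Lemma card_uncovered s : consistent s ->
  (uncovered s == set0) = (covered I (chosen s) == [set: 'I_n]).
Proof. by move=> ->; rewrite -setCT (inj_eq (@setC_inj _)). Qed.

(** The truncated predecessor treats useful and idle steps alike: by coverability, a step without a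
    candidate means that nothing is uncovered. *)
Lemma runs_greedy_step O s : feasible I O -> coverable I ->
  loaded s -> consistent s ->
  runs greedy_step s (B * B) (fun s' => [/\ consistent s',
    potential I O (chosen s') <= potential I O (chosen s) &
    (#|uncovered s'| <= #|uncovered s|.-1)%N]).
Proof.
move=> Ofeas Icov ld cons; have BB : (0 < B * B)%N by rewrite muln_gt0 B_gt0.
apply: runs_seq.
apply: runs_conseq (runs_find_best ld cons) (leqnn _) _ => s1 un1 [b [eb best]].
have ld1 : loaded s1 by apply: loaded_unchanged un1 _ _ _.
have ch1 : chosen s1 = chosen s by rewrite /chosen (un1.1 SEL isT).
have uc1 : uncovered s1 = uncovered s by rewrite /uncovered (un1.1 UNC isT).
have cons1 : consistent s1 by rewrite /consistent ch1 uc1.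
apply: runs_if => //=.
  case: best => [[-> //]|[-> res_gt0 res_min] _].
  apply: runs_seq; apply: runs_nset => //.
  apply: runs_conseq (runs_pick_set (j := b) _ _ _) _ _ => //.
    by rewrite leq_pmulr.
  move=> s2 un2 [ch2 cons2]; split=> //.
    rewrite ch2 [chosen _]ch1; apply: potential_greedy => // S.
    exact: res_min.
  rewrite cons2 cons ch2 [chosen _]ch1.
  have lt := uncovered_greedy res_gt0.
  by rewrite -ltnS prednK //; apply: leq_ltn_trans lt.
rewrite lt0n negbK => /eqP r0; apply: runs_skip => //; rewrite ch1 uc1.
split=> //; case: best => [[_ none]|[_]]; last by rewrite r0.
suff -> : uncovered s = set0 by rewrite cards0.
apply/eqP; rewrite card_uncovered //; apply/negPn/negP => /(residual_gt0 Icov)[j].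
by rewrite none.
Qed.

Lemma runs_greedy O s : feasible I O -> coverable I ->
  loaded s -> consistent s ->
  runs greedy s (B * (B * B)) (fun s' => feasible I (chosen s') /\
    potential I O (chosen s') <= potential I O (chosen s)).
Proof.
move=> Ofeas Icov ld cons; have BB : (0 < B * B)%N by rewrite muln_gt0 B_gt0.
pose Inv k s1 := [/\ consistent s1,
  potential I O (chosen s1) <= potential I O (chosen s) &
  (#|uncovered s1| <= n - k)%N].
apply: (@runs_conseq _ _ _ (B * (B * B)) _ (Inv n)) => //.
  apply: runs_for => //.
  - by move=> s1 un1 /=; rewrite (un1.1 SIZE isT); case: ld.
  - split=> //; rewrite subn0 -[n in (_ <= n)%N]card_ord; exact: max_card.
  move=> k s1 kn un1 _ [cons1 pot1 unc1].
  have ld1 : loaded s1 by apply: loaded_unchanged un1 _ _ _.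
  apply: runs_conseq (runs_greedy_step Ofeas Icov ld1 cons1) (leqnn _) _.
  move=> s2 _ [cons2 pot2 unc2]; split=> //; first exact: le_trans pot1.
  apply: (leq_trans unc2); lia.
by move=> s1 _ [cons1 pot1]; rewrite subnn leqn0 cards_eq0 card_uncovered.
Qed.

(** * Decoding a guess *)

Lemma runs_divide s r M : (0 < M)%N -> (r <= M)%N -> loaded s ->
  nmem s REST 0 = r ->
  runs divide s M (fun s' => nmem s' REST 0 = (r %% m)%N /\
                             nmem s' QUO 0 = (r %/ m)%N).
Proof.
move=> M0 rM ld rest; apply: runs_seq; apply: runs_nset => //=.
set s0 := State _ _; rewrite -[M]muln1.
pose Inv s1 := (nmem s1 QUO 0 * m + nmem s1 REST 0)%N = r.
apply: (@runs_conseq _ _ _ (M * 1) _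
    (fun s1 => (Inv s1 /\ nmem s1 SIZE 1 = m) /\
               ~~ beval s1 (BNLe n_sets (NVar REST)))) => //.
  apply: (runs_while (v := fun s1 => nmem s1 REST 0)) => //.
  - by rewrite /Inv /=; case: ld.
  - by rewrite /= /update /= rest.
  move=> s1 _ [inv m1] /=; rewrite m1 => le.
  apply: runs_seq; apply: runs_nset => //; apply: runs_nset => //.
  rewrite /Inv /= /update /= m1; split; last by move: m_gt0; lia.
  by split=> //; rewrite mulnDl mul1n -addnA subnKC.
move=> s1 _ [[<- m1]] /=; rewrite m1 -ltnNge => lt.
by rewrite modnMDl modn_small // divnMDl // divn_small // addn0.
Qed.

Lemma runs_pick_guess s D c M : (0 < M)%N -> (c <= M)%N -> (D <= B)%N ->
  loaded s -> consistent s -> chosen s = set0 ->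
  nmem s DEPTH 0 = D -> nmem s GUESS 0 = c ->
  runs pick_guess s (B * (B * M)) (fun s' =>
    consistent s' /\ chosen s' = digits m D c).
Proof.
move=> M0 cM DB ld cons ch0 depth guess.
have BM : (0 < B * M)%N by rewrite muln_gt0 B_gt0.
apply: runs_seq; apply: runs_nset => //=; first by rewrite muln_gt0 B_gt0.
set s0 := State _ _.
(* The sets selected so far and those still coded by [REST] together form the whole guess. *)
pose Inv k s1 := [/\ consistent s1, (nmem s1 REST 0 <= M)%N &
  chosen s1 :|: digits m (D - k) (nmem s1 REST 0) = digits m D c].
apply: (@runs_conseq _ _ _ (B * (B * M)) _ (Inv D)) => //; last first.
  by move=> s1 _ [cons1 _]; rewrite subnn setU0.
apply: runs_for => //.
- by move=> s1 un1 /=; rewrite (un1.1 DEPTH isT).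
- rewrite /Inv /= subn0 /update /= guess; split=> //.
  by rewrite [chosen _]ch0 set0U.
move=> k s1 kD un1 _ [cons1 restM chE].
have ld1 : loaded s1 by apply: loaded_unchanged un1 _ _ _.
apply: runs_seq; apply: runs_conseq (runs_divide M0 restM ld1 erefl) _ _.
  by rewrite leq_pmull.
move=> s2 un2 [rest2 quo2].
have ld2 : loaded s2 by apply: loaded_unchanged un2 _ _ _.
have ch2 : chosen s2 = chosen s1 by rewrite /chosen (un2.1 SEL isT).
have cons2 : consistent s2.
  by rewrite /consistent ch2 /uncovered (un2.1 UNC isT).
apply: runs_seq; apply: runs_nset => //=; apply: runs_seq.
set s3 := State _ _; pose j := Ordinal (ltn_pmod (nmem s1 REST 0) m_gt0).
apply: runs_conseq (@runs_pick_set s3 j ld2 rest2 cons2) _ _.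
  by rewrite leq_pmulr.
move=> s4 un4 [ch4 cons4]; apply: runs_nset => //.
rewrite /Inv /= /update /= (un4.1 QUO isT) /= /update /= quo2; split=> //.
  by apply: leq_trans (leq_div _ _) restM.
rewrite [chosen _]ch4 [chosen _]ch2 -chE -(subnSK kD) /= setUCA setUA.
congr (_ :|: _ :|: _).
by apply/setP => i; rewrite !inE.
Qed.

(** * Evaluating covers and keeping the best *)

Lemma runs_compute_total s : loaded s ->
  runs compute_total s B (fun s' => rmem s' TOTAL 0 = total_cost I (chosen s)).
Proof.
move=> ld; apply: runs_seq; apply: runs_rset => //=.
set s0 := State _ _; rewrite -{1}[B]muln1.
pose p k : R := if nmem s SEL k != 0%N then rmem s COST k else 0.
pose Inv k s1 := rmem s1 TOTAL 0 = \sum_(0 <= i < k) p i.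
apply: (@runs_conseq _ _ _ (B * 1) _ (Inv m)) => //.
  apply: runs_for => //.
  - by move=> s1 un1 /=; rewrite (un1.1 SIZE isT) //; case: ld.
  - by rewrite /Inv big_geq.
  move=> k s1 km un1 itk inv1.
  have selE : nmem s1 SEL = nmem s SEL by rewrite (un1.1 SEL isT).
  have costE : rmem s1 COST = rmem s COST by rewrite (un1.2 COST isT).
  apply: runs_if => //=; rewrite itk selE lt0n => h.
    apply: runs_rset => //; rewrite /Inv /= big_nat_recr //= -inv1.
    by rewrite /update /= itk costE /p h.
  by apply: runs_skip => //; rewrite /Inv /= big_nat_recr //= -inv1 /p (negbTE h) addr0.
move=> s1 _ ->; rewrite big_mkord /total_cost [RHS]big_mkcond /=.
by apply: eq_bigr => j _; rewrite /p inE (loaded_cost _ ld).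
Qed.

Lemma runs_save s : loaded s ->
  runs save s B (fun s' => rmem s' BEST 0 = rmem s TOTAL 0 /\
                           output m s' = chosen s).
Proof.
move=> ld; apply: runs_seq; apply: runs_rset => //=.
set s0 := State _ _.
apply: runs_conseq (@runs_fill OUT _ s0 m (nmem s SEL) 1 isT mB isT _ _) (leqnn _) _.
- by case: ld.
- by move=> k s1 _ un1 itk /=; rewrite itk (un1.1 SEL isT).
move=> s1 un1 outE; rewrite (un1.2 BEST isT); split=> //.
by apply/setP => j; rewrite !inE outE.
Qed.

(** The record is measured against the potential of the guesses already tried, not the cost of their
    completions: that is what the choice of a good guess bounds. *)
Definition record_holder O D (k : nat) s : Prop :=
  [/\ feasible I (output m s), rmem s BEST 0 = total_cost I (output m s) &
      forall c, (c < k)%N ->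
        total_cost I (output m s) <= potential I O (digits m D c)].

Lemma runs_attempt O D M s c : feasible I O -> coverable I ->
  (0 < M)%N -> (c <= M)%N -> (D <= B)%N ->
  loaded s -> nmem s DEPTH 0 = D -> nmem s GUESS 0 = c ->
  record_holder O D c s ->
  runs attempt s (B * (B * B) * M) (record_holder O D c.+1).
Proof.
move=> Ofeas Icov M0 cM DB ld depth guess [feas best rec].
set Y := (B * (B * B) * M)%N.
have le_BY : (B <= Y)%N.
  by rewrite /Y -!mulnA leq_pmulr // !muln_gt0 B_gt0.
have Y0 : (0 < Y)%N := leq_trans B_gt0 le_BY.
apply: runs_seq.
apply: (runs_conseq (@runs_fill SEL _ s m (fun=> 0%N) 1 isT mB isT _ _) le_BY _) => //.
  by case: ld.
move=> s1 un1 sel1; have ld1 : loaded s1 by apply: loaded_unchanged un1 _ _ _.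
apply: runs_seq.
apply: (runs_conseq (@runs_fill UNC _ s1 n (fun=> 1%N) 0 isT nB isT _ _) le_BY _) => //.
  by case: ld1.
move=> s2 un2 unc2; have ld2 : loaded s2 by apply: loaded_unchanged un2 _ _ _.
have ch2 : chosen s2 = set0.
  by apply/setP => j; rewrite !inE (un2.1 SEL isT) sel1.
have cons2 : consistent s2.
  by rewrite /consistent ch2 covered0 setC0; apply/setP => i; rewrite !inE unc2.
apply: runs_seq.
apply: runs_conseq (runs_pick_guess M0 cM DB ld2 cons2 ch2 _ _) _ _.
- by rewrite (un2.1 DEPTH isT) (un1.1 DEPTH isT).
- by rewrite (un2.1 GUESS isT) (un1.1 GUESS isT).
- by rewrite /Y -!mulnA leq_mul2l leq_mul2l leq_pmull ?orbT.
move=> s3 un3 [cons3 ch3].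
have ld3 : loaded s3 by apply: loaded_unchanged un3 _ _ _.
apply: runs_seq.
apply: runs_conseq (runs_greedy Ofeas Icov ld3 cons3) _ _.
  by rewrite /Y leq_pmulr.
move=> s4 un4 [feas4 pot4].
have ld4 : loaded s4 by apply: loaded_unchanged un4 _ _ _.
apply: runs_seq.
apply: (runs_conseq (runs_compute_total ld4) le_BY _) => s5 un5 tot5.
have ld5 : loaded s5 by apply: loaded_unchanged un5 _ _ _.
have ch5 : chosen s5 = chosen s4 by rewrite /chosen (un5.1 SEL isT).
have out5 : output m s5 = output m s.
  by apply/setP => j; rewrite !inE (un5.1 OUT isT) (un4.1 OUT isT) (un3.1 OUT isT)
    (un2.1 OUT isT) (un1.1 OUT isT).
have best5 : rmem s5 BEST 0 = total_cost I (output m s).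
  by rewrite (un5.2 BEST isT) (un4.2 BEST isT) (un3.2 BEST isT)
    (un2.2 BEST isT) (un1.2 BEST isT).
rewrite ch3 in pot4.
(* Greedy does not raise the potential, so the completed cover costs at most the potential of the
   bare guess. *)
have cost4 := le_trans (total_cost_le_potential I O (chosen s4)) pot4.
apply: runs_if => //=; rewrite best5 tot5.
  move=> le; apply: (runs_conseq (runs_save ld5) le_BY _) => s6 _ [best6 out6].
  rewrite /record_holder best6 out6 ch5 tot5; split=> // c'.
  rewrite ltnS leq_eqVlt => /orP[/eqP -> //|/rec].
  exact: le_trans.
rewrite -ltNge => /ltW le; apply: runs_skip => //.
rewrite /record_holder out5 best5; split=> // c'.
rewrite ltnS leq_eqVlt => /orP[/eqP -> //|/rec //].
exact: le_trans cost4.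
Qed.

(** * Initialization *)

Lemma runs_compute_rows s : nmem s = nmem (input I d) ->
  rmem s = rmem (input I d) -> runs compute_rows s B loaded.
Proof.
move=> ns rs; rewrite -[B]muln1.
pose Inv k s1 := forall j, (j <= k)%N -> nmem s1 ROW j = (j * n)%N.
apply: (@runs_conseq _ _ _ (B * 1) _ (Inv m)) => //; last first.
  move=> s1 un1 inv1; split.
  - by rewrite (un1.1 SIZE isT) ns.
  - by rewrite (un1.1 SIZE isT) ns.
  - by rewrite (un1.1 INC isT) ns.
  - by rewrite (un1.2 COST isT) rs.
  - by move=> j jm; apply: inv1; apply: ltnW.
apply: runs_for => //.
- by move=> s1 un1 /=; rewrite (un1.1 SIZE isT) ns.
- by move=> j; rewrite leqn0 => /eqP ->; rewrite /= /update /= ns.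
move=> k s1 km un1 jk inv1; apply: runs_nset => // j.
rewrite /= /update /= jk addn1 (un1.1 SIZE isT) ns /= inv1 // leq_eqVlt.
case: (altP (j =P k.+1)) => [-> _|_ /= jk1]; first by rewrite mulSn addnC.
exact: inv1.
Qed.

Lemma runs_compute_depth s : d <= n%:R -> 0 <= d -> rmem s PARAM 0 = d ->
  rmem s FLOOR 0 = 0 -> nmem s DEPTH 0 = 0%N ->
  runs compute_depth s B (fun s' =>
    (nmem s' DEPTH 0)%:R <= d < (nmem s' DEPTH 0).+1%:R).
Proof.
move=> dn d0 par fl dep; rewrite -[B]muln1.
pose Inv s1 := [/\ rmem s1 FLOOR 0 = (nmem s1 DEPTH 0)%:R,
  (nmem s1 DEPTH 0)%:R <= d & rmem s1 PARAM 0 = d].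
apply: (@runs_conseq _ _ _ (B * 1) _ (fun s1 => Inv s1 /\
    ~~ beval s1 (BRLe (RAdd (RVar FLOOR) ROne) (RVar PARAM)))) => //; last first.
  move=> s1 _ [[fl1 le1 par1]] /=.
  by rewrite fl1 par1 -ltNge -natr1 le1 => ->.
(* The counter stays below [d <= n], which makes this a decreasing variant. *)
apply: (runs_while (v := fun s1 => n - nmem s1 DEPTH 0)%N) => //.
- by rewrite /Inv fl dep par.
- by rewrite dep subn0.
move=> s1 _ [fl1 le1 par1] /=; rewrite fl1 par1 natr1 => le2.
apply: runs_seq; apply: runs_rset => //; apply: runs_nset => //.
rewrite /Inv /= /update /= fl1 addn1 natr1; split=> //.
have : (nmem s1 DEPTH 0).+1%:R <= n%:R :> R by apply: le_trans dn.
by rewrite ler_nat; lia.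
Qed.

Lemma runs_compute_guesses s D : loaded s -> nmem s DEPTH 0 = D ->
  (D <= B)%N ->
  runs compute_guesses s (B * B) (fun s' => nmem s' GUESSES 0 = (m ^ D)%N).
Proof.
move=> ld dep DB; have BB : (0 < B * B)%N by rewrite muln_gt0 B_gt0.
apply: runs_seq; apply: runs_nset => //=.
set s0 := State _ _.
pose Inv k s1 := nmem s1 GUESSES 0 = (m ^ k)%N.
apply: (runs_for (Inv := Inv)) => //.
- by move=> s1 un1 /=; rewrite (un1.1 DEPTH isT).
move=> k s1 kD un1 _ inv1; apply: runs_seq; apply: runs_nset => //; apply: runs_seq.
set s2 := State _ _; rewrite -{1}[B]muln1.
pose Inv2 i s3 := nmem s3 CNT 0 = (i * m ^ k)%N.
apply: (@runs_conseq _ _ _ (B * 1) _ (Inv2 m)); rewrite ?muln1 //.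
  rewrite -{1}[B]muln1; apply: runs_for => //.
  - by move=> s3 un3 /=; rewrite (un3.1 SIZE isT) /= /update /= (un1.1 SIZE isT); case: ld.
  move=> i s3 im un3 _ inv3; apply: runs_nset => //.
  rewrite /Inv2 /= /update /= inv3 (un3.1 GUESSES isT) /= /update /= inv1.
  by rewrite mulSn addnC.
move=> s3 un3 inv3; apply: runs_nset => //.
by rewrite /Inv /= /update /= inv3 expnS.
Qed.

Lemma runs_initialize : 1 <= d <= n%:R -> coverable I ->
  runs initialize (input I d) (B * B) (fun s => loaded s /\ exists D,
    [/\ D%:R <= d < D.+1%:R, nmem s DEPTH 0 = D, nmem s GUESSES 0 = (m ^ D)%N &
      forall O, record_holder O D 0 s]).
Proof.
move=> /andP[d1 dn] Icov.
have BB : (B <= B * B)%N by rewrite leq_pmulr.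
apply: runs_seq; apply: (runs_conseq (runs_compute_rows _ _) BB _) => //.
move=> s1 un1 ld1.
apply: runs_seq; apply: (runs_conseq (runs_compute_depth dn _ _ _ _) BB _).
- exact: le_trans d1.
- by rewrite (un1.2 PARAM isT).
- by rewrite (un1.2 FLOOR isT).
- by rewrite (un1.1 DEPTH isT).
move=> s2 un2; set D := nmem s2 DEPTH 0 => floorD.
have ld2 : loaded s2 by apply: loaded_unchanged un2 _ _ _.
have DB : (D <= B)%N.
  apply: leq_trans nB; rewrite -(ler_nat R); apply: le_trans dn.
  by case/andP: floorD.
apply: runs_seq; apply: runs_conseq (runs_compute_guesses ld2 erefl DB) (leqnn _) _.
move=> s3 un3 gue3; have ld3 : loaded s3 by apply: loaded_unchanged un3 _ _ _.
apply: runs_seq.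
apply: (runs_conseq (@runs_fill SEL _ s3 m (fun=> 1%N) 1 isT mB isT _ _) BB _) => //.
  by case: ld3.
move=> s4 un4 sel4; have ld4 : loaded s4 by apply: loaded_unchanged un4 _ _ _.
have ch4 : chosen s4 = [set: 'I_m] by apply/setP => j; rewrite !inE sel4.
apply: runs_seq.
apply: (runs_conseq (runs_compute_total ld4) BB _) => s5 un5 tot5.
have ld5 : loaded s5 by apply: loaded_unchanged un5 _ _ _.
have ch5 : chosen s5 = [set: 'I_m] by rewrite -ch4 /chosen (un5.1 SEL isT).
apply: (runs_conseq (runs_save ld5) BB _) => s6 un6 [best6 out6].
split; first by apply: loaded_unchanged un6 _ _ _.
exists D; split=> //.
- by rewrite (un6.1 DEPTH isT) (un5.1 DEPTH isT) (un4.1 DEPTH isT) (un3.1 DEPTH isT).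
- by rewrite (un6.1 GUESSES isT) (un5.1 GUESSES isT) (un4.1 GUESSES isT).
by move=> O; split=> //; rewrite out6 ch5 // best6 tot5 ch4.
Qed.

(** * The whole program: approximation ratio and running time *)

Lemma runs_set_cover_program O : feasible I O -> 1 <= d <= n%:R ->
  coverable I ->
  exists D, D%:R <= d < D.+1%:R /\
    exists t s, [/\ exec set_cover_program (input I d) t s,
      (t <= weight set_cover_program * (B ^ 3 * (m ^ D) ^ 2))%N &
      record_holder O D (m ^ D) s].
Proof.
move=> Ofeas Hd Icov.
have [t1 [s1 [e1 le1 [ld1 [D [floorD dep1 gue1 rec1]]]]]] :=
  runs_initialize Hd Icov.
exists D; split=> //; set M := (m ^ D)%N.
have M0 : (0 < M)%N by rewrite expn_gt0 m_gt0.
have DB : (D <= B)%N.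
  apply: leq_trans nB; rewrite -(ler_nat R).
  by case/andP: floorD => /le_trans le _; apply: le; case/andP: Hd.
(* The outer [M] counts the guesses, the inner one bounds the repeated subtractions of a division,
   and the cube of [B] comes from the nested loops of greedy. *)
have : runs set_cover_program (input I d) (M * (B * (B * B) * M))
    (record_holder O D M).
  apply: runs_seq; exists t1, s1; split=> //.
    apply: leq_trans le1 _; rewrite leq_mul2l.
    have -> : (M * (B * (B * B) * M) = B * B * (B * M * M))%N by ring.
    by rewrite leq_pmulr ?orbT // !muln_gt0 B_gt0 M0.
  apply: (runs_for (Inv := record_holder O D)) => //.
  - by rewrite !muln_gt0 B_gt0.
  - by move=> s2 un2 /=; rewrite (un2.1 GUESSES isT).
  - exact: (rec1 O).
  move=> k s2 kM un2 guess2 rec2.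
  have ld2 : loaded s2 by apply: loaded_unchanged un2 _ _ _.
  apply: (runs_conseq (runs_attempt Ofeas Icov M0 (ltnW kM) DB ld2 _ guess2 rec2)) => //.
  by rewrite (un2.1 DEPTH isT).
move=> [t [s [e le rec]]]; exists t, s; split=> //.
by have -> : (B ^ 3 * M ^ 2 = M * (B * (B * B) * M))%N by ring.
Qed.

End Correctness.

Theorem theorem1 (R : realType) :
  exists (P : program) (K a b : nat),
    forall (n m : nat) (I : instance R n m) (d : R),
      1 <= d <= n%:R ->
      coverable I ->
      exists (t : nat) (s : state R),
        [/\ exec P (input I d) t s,
            approximate_solution I (harmonic_number (n%:R / d)) (output m s)
          & t%:R <= K%:R * (n + m)%:R ^+ a * (m%:R `^ (b%:R * d))].
Proof.
(* The exponents are those of [B ^ 3 * (m ^ D) ^ 2]. *)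
exists set_cover_program, (weight set_cover_program), 3%N, 2%N => n m I d Hd Icov.
have /andP[d1 dn] := Hd.
have d0 : 0 < d by apply: lt_le_trans d1.
have n0 : (0 < n)%N by rewrite -(ltr_nat R); apply: lt_le_trans dn.
have m0 : (0 < m)%N.
  have : Ordinal n0 \in covered I setT by rewrite /covered (eqP Icov) inE.
  by case/bigcupP => j _ _; apply: leq_ltn_trans (ltn_ord j).
(* From here on [O] is an optimal cover; it enters only the analysis, never the program. *)
rewrite /approximate_solution /optimum; case: arg_minP => // O Ofeas _.
have [D [/andP[Dd dD] [t [s [e le [feas _ rec]]]]]] :=
  runs_set_cover_program m0 Ofeas Hd Icov.
have D0 : (0 < D)%N by rewrite -ltnS -(ltr_nat R); apply: le_lt_trans dD.
exists t, s; split=> //.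
  split=> //; set N := Num.truncn (n%:R / d).
  have /truncn_itv/andP[Nle ltN] : 0 <= n%:R / d by rewrite divr_ge0 ?ler0n ?ltW.
  have N0 : (0 < N)%N.
    rewrite -ltnS -(ltr_nat R); apply: le_lt_trans ltN.
    by rewrite ler_pdivlMr // mul1r.
  (* Truncation gives [n < N.+1 * d], and [d < D.+1]. *)
  have nND : (n < N.+1 * D.+1)%N.
    rewrite -(ltr_nat R) natrM; move: ltN; rewrite ltr_pdivrMr // => /lt_trans; apply.
    by rewrite ltr_pM2l ?ltr0n.
  have [l [lD le_l]] := guess_exists Ofeas n0 N0 D0 nND.
  have [c cM cE] := digits_surj l.
  rewrite lD in cM cE; apply: le_trans (rec c cM) _.
  by rewrite cE.
(* For the time bound, [m ^ D] is at most the real power with exponent [d], since [D <= d] and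
   [m >= 1]. *)
move: le; rewrite -(ler_nat R) => /le_trans; apply.
rewrite natrM -mulrA ler_wpM2l ?ler0n // natrM natrX ler_wpM2l ?exprn_ge0 ?ler0n //.
rewrite natrX mulrC powRrM powR_mulrn ?powR_ge0 //.
rewrite lerXn2r ?nnegrE ?ler0n ?powR_ge0 // natrX -powR_mulrn ?ler0n //.
by rewrite ler_powR // ler1n.
Qed.
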